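(* Let $a\ge 1$ and let $\vec p=(p_1,\dots,p_a)$ be a probability vector. Let $E_{n,a,\vec p}$ denote expectation with respect to the biased $a$-shuffle measure $P_{n,a;\vec p}$ on $S_n$, and let $Inv(\pi)$ be the number of inversions of $\pi$. Then, as formal power series in $u$, $$\sum_{n=0}^{\infty}\frac{u^n}{[n]!}\,E_{n,a,\vec p}\big[q^{Inv}\big]=\prod_{i=1}^a\left[\sum_{j=0}^\infty\frac{(up_i)^j}{[j]!}\right]=\prod_{i=1}^a\prod_{j=0}^\infty\frac{1}{1-up_i(1-q)q^j},$$ where the first equality holds with coefficients that are rational functions in the indeterminate $q$, and the second equality holds when $|q|<1$ (the infinite product being the coefficientwise limit, as power series in $u$, of its finite partial products).
   Context: Probability vector: real $p_i\ge 0$ with $\sum_{i=1}^a p_i=1$. The $n=0$ term on the left equals $1$. $[n]!=\prod_{i=0}^{n-1}(1+q+\cdots+q^i)$, with $[0]!=1$. $Inv(\pi)$ is the number of pairs $i<j$ with $\pi(i)>\pi(j)$. Descents: $\pi\in S_n$ has a descent at position $i$ ($1\le i\le n-1$) if $\pi(i)>\pi(i+1)$; by convention every $\pi\in S_n$ also has a descent at position $n$. The descent set of $\pi$ is the set of positions at which it has a descent. The measure $P_{n,a;\vec p}$ on $S_n$ (biased riffle shuffle): first choose $(b_1,\dots,b_a)$, $b_i\ge 0$, $b_1+\cdots+b_a=n$, with probability $\binom{n}{b_1\cdots b_a}\prod_{i=1}^a p_i^{b_i}$; then choose uniformly one of the $\binom{n}{b_1\cdots b_a}$ permutations $\pi\in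 S_n$ such that the descent set of $\pi^{-1}$ is contained in $\{b_1,b_1+b_2,\dots,b_1+\cdots+b_a=n\}$. *)

(* Defs.v *)
From HB Require Import structures.
From mathcomp Require Import all_boot all_order all_algebra all_fingroup.
From mathcomp Require Import boolp classical_sets reals topology normedtype.
From mathcomp Require Export complex.
Set Implicit Arguments.
Unset Strict Implicit.
Unset Printing Implicit Defensive.
Import Order.TTheory GRing.Theory Num.Theory.
Import numFieldNormedType.Exports.
Local Open Scope ring_scope.

(* The ring of formal power series in one variable over a field.  It is a     *)
(* record rather than a synonym for nat -> K so that the pointwise product of *)
(* functions is not picked up as its multiplication.                          *)
Record fps (K : fieldType) := FPS { coefs : nat -> K }.

Section FPSRing.
Variable K : fieldType.
Implicit Types f g h : fps K.

HB.instance Definition _ := [isNew for @coefs K].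
HB.instance Definition _ := [Choice of fps K by <:].

Lemma fpsP f g : (forall n, coefs f n = coefs g n) -> f = g.
Proof. by case: f => f; case: g => g /= /funext ->. Qed.

Definition fps_add f g := FPS (fun n => coefs f n + coefs g n).
Definition fps_opp f := FPS (fun n => - coefs f n).
Definition fps_zero : fps K := FPS (fun=> 0).
Definition fpsC (c : K) : fps K := FPS (fun n => if n == 0%N then c else 0).
Definition fpsX : fps K := FPS (fun n => (n == 1%N)%:R).
Definition fps_mul f g :=
  FPS (fun n => \sum_(i < n.+1) coefs f i * coefs g (n - i)%N).

Fact fps_addA : associative fps_add.
Proof. by move=> f g h; apply: fpsP => n /=; rewrite addrA. Qed.
Fact fps_addC : commutative fps_add.
Proof. by move=> f g; apply: fpsP => n /=; rewrite addrC. Qed.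
Fact fps_add0 : left_id fps_zero fps_add.
Proof. by move=> f; apply: fpsP => n /=; rewrite add0r. Qed.
Fact fps_addN : left_inverse fps_zero fps_opp fps_add.
Proof. by move=> f; apply: fpsP => n /=; rewrite addNr. Qed.

HB.instance Definition _ :=
  GRing.isZmodule.Build (fps K) fps_addA fps_addC fps_add0 fps_addN.

Definition fps_trunc (n : nat) f : {poly K} := \poly_(i < n.+1) coefs f i.

Lemma coef_fps_mul n f g m : (m <= n)%N ->
  coefs (fps_mul f g) m = (fps_trunc n f * fps_trunc n g)`_m.
Proof.
move=> le_mn; rewrite coefM /=; apply: eq_bigr => i _.
have le_in : (i <= n)%N by rewrite (leq_trans _ le_mn) // -ltnS.
by rewrite !coef_poly !ltnS le_in (leq_trans (leq_subr _ _) le_mn).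
Qed.

Fact fps_mulC : commutative fps_mul.
Proof.
by move=> f g; apply: fpsP => n; rewrite !(@coef_fps_mul n) // mulrC.
Qed.

Fact fps_mulA : associative fps_mul.
Proof.
move=> f g h; apply: fpsP => n; set t := fps_trunc n.
transitivity ((t f * (t g * t h))`_n).
  rewrite coefM; apply: eq_bigr => i _.
  rewrite (@coef_fps_mul n) ?leq_subr // /t {3}/fps_trunc coef_poly.
  by rewrite ltn_ord.
rewrite mulrA coefM; apply: eq_bigr => i _.
rewrite -(@coef_fps_mul n) -1?ltnS // /t {1}/fps_trunc coef_poly.
by rewrite ltnS leq_subr.
Qed.

Fact fps_mul1 : left_id (fpsC 1) fps_mul.
Proof.
move=> f; apply: fpsP => n; rewrite /= big_ord_recl /= mul1r subn0.
by rewrite big1 ?addr0 // => i _; rewrite mul0r.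
Qed.

Fact fps_mulDl : left_distributive fps_mul fps_add.
Proof.
move=> f g h; apply: fpsP => n; rewrite /= -big_split /=.
by apply: eq_bigr => i _; rewrite mulrDl.
Qed.

Fact fps_1neq0 : fpsC 1 != 0.
Proof.
by apply/eqP => /(congr1 (fun f => coefs f 0)) /eqP /=; rewrite oner_eq0.
Qed.

HB.instance Definition _ := GRing.Zmodule_isComNzRing.Build (fps K)
  fps_mulA fps_mulC fps_mul1 fps_mulDl fps_1neq0.

(* The first n.+1 coefficients of the inverse of f, when coefs f 0 != 0. *)
Fixpoint fps_inv_seq f (n : nat) : seq K :=
  if n is n'.+1 then
    let s := fps_inv_seq f n' in
    rcons s (- (coefs f 0)^-1 * \sum_(i < n) coefs f i.+1 * s`_(n' - i))
  else [:: (coefs f 0)^-1].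

Definition fps_unit : pred (fps K) := fun f => coefs f 0 != 0.

(* As for every MathComp unit ring, non-units are their own inverse. *)
Definition fps_inv f :=
  if fps_unit f then FPS (fun n => (fps_inv_seq f n)`_n) else f.

Lemma size_fps_inv_seq f n : size (fps_inv_seq f n) = n.+1.
Proof. by elim: n => //= n IHn; rewrite size_rcons IHn. Qed.

Lemma nth_fps_inv_seq f n m : (m <= n)%N ->
  (fps_inv_seq f n)`_m = (fps_inv_seq f m)`_m.
Proof.
elim: n => [|n IHn]; first by rewrite leqn0 => /eqP ->.
rewrite leq_eqVlt => /predU1P[-> // | lt_mn].
by rewrite /= nth_rcons size_fps_inv_seq lt_mn IHn.
Qed.

Fact fps_mulV : {in fps_unit, left_inverse 1 fps_inv *%R}.
Proof.
move=> f uf; have f0 : coefs f 0 != 0 by [].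
rewrite mulrC /fps_inv /fps_unit f0.
apply: fpsP => -[|n]; first by rewrite /= big_ord1 /= divff.
rewrite /= big_ord_recl subn0 nth_rcons size_fps_inv_seq ltnn eqxx.
rewrite mulrA mulrN divff // mulN1r; apply/eqP.
rewrite addrC subr_eq0; apply/eqP/eq_bigr => i _.
by rewrite subSS [in RHS]nth_fps_inv_seq ?leq_subr.
Qed.

Fact fps_unitP f g : g * f = 1 -> fps_unit f.
Proof.
move=> /(congr1 (fun h => coefs h 0)); rewrite /= big_ord1 /= /fps_unit => gf.
by apply: contra_eq_neq gf => ->; rewrite mulr0 eq_sym oner_eq0.
Qed.

Fact fps_inv_out : {in [predC fps_unit], fps_inv =1 id}.
Proof. by move=> f /negPf uf; rewrite /fps_inv [fps_unit f]uf. Qed.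

HB.instance Definition _ := GRing.ComNzRing_hasMulInverse.Build (fps K)
  fps_mulV fps_unitP fps_inv_out.

End FPSRing.

(* C^o carries the topology of the absolute value of C.  The limit below is   *)
(* meaningful only under fps_cvgn.                                            *)
Definition fps_cvgn (C : numFieldType) (F : nat -> fps C) : Prop :=
  forall n : nat, cvgn (fun N => coefs (F N) n : C^o).

Definition fps_limn (C : numFieldType) (F : nat -> fps C) : fps C :=
  FPS (fun n : nat => limn (fun N => coefs (F N) n : C^o)).

Definition fps_partprod (C : numFieldType) (F : nat -> fps C) (N : nat) :
    fps C :=
  \prod_(j < N) F j.

Definition fps_infprod (C : numFieldType) (F : nat -> fps C) : fps C :=
  fps_limn (fps_partprod F).

Definition qfact (K : fieldType) (q : K) (n : nat) : K :=
  \prod_(i < n) \sum_(j < i.+1) q ^+ j.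

Definition inv_nb (n : nat) (s : 'S_n) : nat :=
  #|[set ij : 'I_n * 'I_n | (ij.1 < ij.2)%N && (s ij.2 < s ij.1)%N]|.

(* Permutations act on {0, ..., n-1}, but descent positions are numbered      *)
(* 1, ..., n: position k compares the values at the 0-based indices k-1 and   *)
(* k, and position n is a descent by convention.                              *)
Definition descents (n : nat) (s : 'S_n) : {set 'I_n.+1} :=
  [set k : 'I_n.+1 | (k == n :> nat) ||
     [exists i : 'I_n, exists j : 'I_n,
        [&& i.+1 == k, j == k :> nat & (s j < s i)%N]]].

(* The biased riffle shuffle: pile sizes b follow the multinomial law, then   *)
(* the permutation is uniform among those whose inverse has all its descents  *)
(* at the partial sums of b.                                                  *)
Section Shuffle.
Variables (R : realFieldType) (a : nat) (p : 'I_a -> R) (n : nat).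

Definition pile_sizes : {set {ffun 'I_a -> 'I_n.+1}} :=
  [set b : {ffun 'I_a -> 'I_n.+1} | (\sum_i b i)%N == n].

Definition cuts (b : {ffun 'I_a -> 'I_n.+1}) : {set 'I_n.+1} :=
  [set k : 'I_n.+1 | [exists i : 'I_a, k == (\sum_(j < a | j <= i) b j)%N :> nat]].

Definition shuffles (b : {ffun 'I_a -> 'I_n.+1}) : {set 'S_n} :=
  [set s : 'S_n | descents (s^-1)%g \subset cuts b].

Definition pile_prob (b : {ffun 'I_a -> 'I_n.+1}) : R :=
  (n`!%:R / \prod_i (b i)`!%:R) * \prod_i p i ^+ b i.

Definition shuffle_prob (s : 'S_n) : R :=
  \sum_(b in pile_sizes)
     pile_prob b * (if s \in shuffles b then #|shuffles b|%:R^-1 else 0).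

(* The random variable takes values in a field K containing R, such as R(q).  *)
Definition shuffle_expect (K : fieldType) (iota : {rmorphism R -> K})
    (f : 'S_n -> K) : K :=
  \sum_(s : 'S_n) iota (shuffle_prob s) * f s.

End Shuffle.

Section Series.
Variables (R : realFieldType) (a : nat) (p : 'I_a -> R).
Variables (K : fieldType) (iota : {rmorphism R -> K}) (q : K).

(* Coefficient n of these series is the coefficient of u^n. *)
Definition inv_gf : fps K :=
  FPS (fun n =>
    shuffle_expect p iota (fun s : 'S_n => q ^+ inv_nb s) / qfact q n).

(* sum_j (u c)^j / [j]! *)
Definition qexp (c : K) : fps K := FPS (fun j => c ^+ j / qfact q j).

End Series.

Notation ratfun R := {fraction {poly R}}.

Definition ratfunC (R : realFieldType) : {rmorphism R -> ratfun R} :=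
  (@tofrac {poly R} \o @polyC R)%FUN.

Definition ratfunX (R : realFieldType) : ratfun R := tofrac 'X.

Definition RtoC (R : rcfType) : {rmorphism R -> R[i]} := real_complex R.

(* The factor 1 / (1 - u c (1 - q) q^j), with u the series variable. *)
Definition euler_factor (C : numFieldType) (q c : C) (j : nat) : fps C :=
  (1 - fpsX C * fpsC (c * (1 - q) * q ^+ j))^-1.

(* Main.v *)
Require Import Defs.
From HB Require Import structures.
From mathcomp Require Import boolp classical_sets topology normedtype sequences.
From mathcomp Require Import all_boot all_order all_algebra.
From mathcomp Require Import reals.
From mathcomp Require Import all_fingroup zify ring.
Import Order.TTheory GRing.Theory Num.Theory.
Import numFieldNormedType.Exports.
Local Open Scope ring_scope.

Set Implicit Arguments.
Unset Strict Implicit.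
Unset Printing Implicit Defensive.

(* If b = (b_1, ..., b_a) are the pile sizes, the permutations whose inverse  *)
(* has its descents at the partial sums of b satisfy                          *)
(*   sum q^Inv = [n]! / ([b_1]! ... [b_a]!),                                  *)
(* by induction on n: the maximum of the inverse sits at the end of some pile *)
(* and removing it shortens that pile by one.  At q = 1 this counts the       *)
(* permutations, so the multinomial factors of the measure cancel and the     *)
(* coefficient of u^n is the sum over b of prod p_i^b_i / [b_i]!.  The second *)
(* equality is the limit N -> oo of the q-binomial theorem for                *)
(* prod_(j < N) 1 / (1 - u c (1 - q) q^j).                                    *)

(** The combinatorial core is the q-multinomial identity [color_increasing_inv_sum], for
    permutations increasing on each class of a monotone coloring of positions. By
    [descents_sub_cuts] and [inv_nbV] these are, up to inversion and with the same Inv, the shuffles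
    with given pile sizes. In S_(n+1), a maximum at position i, counted from 0, must be last in its
    class; deleting it removes n - i inversions and shortens that class by one. The classes are
    consecutive intervals, so the sum of q^(n-i) [size of the class of i] over last positions i is
    [n+1] ([color_last_sum]), which matches [n+1]! = [n+1] [n]!.

    At q = 1 the identity counts shuffles, so each shuffle for b gets weight prod p_i^b_i
    ([pile_prob_shuffles]). Expanding the product of q-exponentials over the same tuples b gives the
    first equality ([inv_gf_prod]).

    For the second, [coef_euler_partprod] gives the coefficients of the partial products in closed
    form; N enters only through factors 1 - q^(N+i), which tend to 1. *)

Lemma card_ord_lt (n m : nat) : (m <= n)%N -> #|[pred i : 'I_n | (i < m)%N]| = m.
Proof.
by move=> le_mn; rewrite -sum1_card (big_ord_narrow le_mn) sum1_card card_ord.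
Qed.

(** A down-closed set of ordinals is the initial segment of length its cardinal. This turns
    conditions on monotone colorings into comparisons of positions. *)
Lemma downset_ord (n : nat) (A : {pred 'I_n}) (i : 'I_n) :
    (forall j k : 'I_n, (j <= k)%N -> k \in A -> j \in A) ->
  (i \in A) = (i < #|A|)%N.
Proof.
move=> downA; apply/idP/idP => [Ai | ].
  rewrite -(@card_ord_lt n i.+1) //; apply/subset_leq_card/subsetP => j.
  by rewrite inE ltnS => /downA; apply.
apply: contraTT => nAi; rewrite -leqNgt.
rewrite -[leqRHS](card_ord_lt (ltnW (ltn_ord i))); apply/subset_leq_card/subsetP => j Aj.
by rewrite inE ltnNge; apply: contra nAi => /downA; apply.
Qed.

(** * Inversions under insertion of the maximum *)

Lemma lift_perm_max_bij (n : nat) :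
  bijective (fun x : 'I_n.+1 * 'S_n => lift_perm x.1 ord_max x.2).
Proof.
apply: inj_card_bij; last by rewrite card_prod card_ord !card_Sn factS.
move=> [i s] [j t] /= eq_st.
have eq_ij : i = j.
  by apply: (@perm_inj _ (lift_perm j ord_max t)); rewrite -{1}eq_st !lift_perm_id.
subst j; congr (_, _); apply/permP => k; apply: (@lift_inj _ ord_max).
by rewrite -!(lift_perm_lift i) eq_st.
Qed.

Lemma inv_nb_sum (n : nat) (s : 'S_n) :
  inv_nb s = (\sum_(i < n) \sum_(j < n) ((i < j) && (s j < s i)))%N.
Proof.
rewrite /inv_nb -sum1_card pair_bigA /= big_mkcond /=.
by apply: eq_bigr => -[i j] _; rewrite inE /=; case: ifP.
Qed.

Lemma inv_nbV (n : nat) (s : 'S_n) : inv_nb (s^-1)%g = inv_nb s.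
Proof.
rewrite !inv_nb_sum (reindex_inj (@perm_inj _ s)) exchange_big /=.
rewrite (reindex_inj (@perm_inj _ s)) /=; apply: eq_bigr => i _.
by apply: eq_bigr => j _; rewrite !permK andbC.
Qed.

Lemma ltn_lift (n : nat) (i : 'I_n.+1) (j k : 'I_n) :
  (lift i j < lift i k)%N = (j < k)%N.
Proof. by rewrite /= /bump; lia. Qed.

(** The maximum at position i is inverted with each of the n - i later positions and with no earlier
    one. *)
Lemma inv_nb_lift_perm_max (n : nat) (i : 'I_n.+1) (s : 'S_n) :
  inv_nb (lift_perm i ord_max s) = (inv_nb s + (n - i))%N.
Proof.
rewrite !inv_nb_sum (bigD1_ord i) //= addnC; congr (_ + _)%N.
  apply: eq_bigr => j _; rewrite (bigD1_ord i) // lift_perm_id lift_perm_lift.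
  rewrite [(ord_max < _)%N]ltnNge leq_ord andbF.
  rewrite /= add0n.
  by apply: eq_bigr => k _; rewrite lift_perm_lift !ltn_lift.
rewrite (bigD1_ord i) //= ltnn add0n.
have -> : (n - i = \sum_(j < n) (i <= j))%N.
  rewrite -{1}(@card_ord_lt n i) -1?ltnS // -[X in (X - _)%N]card_ord.
  rewrite -(cardC [pred j : 'I_n | (j < i)%N]) addKn -sum1_card big_mkcond /=.
  by apply: eq_bigr => j _; rewrite !inE -leqNgt; case: ifP.
apply: eq_bigr => j _; rewrite lift_perm_id lift_perm_lift.
by congr (nat_of_bool _); have := ltn_ord (s j); rewrite /= /bump; lia.
Qed.

(** * Permutations increasing on the classes of a coloring *)

(** Colorings stand in for pile sizes because deleting position i is then just composition with
    [lift i], and classes may be empty. *)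
Definition color_increasing (n : nat) (c : 'I_n -> nat) (s : 'S_n) : bool :=
  [forall i : 'I_n, forall j : 'I_n,
     ((i < j)%N && (c i == c j)) ==> (s i < s j)%N].

(** For monotone [c] the colors up to [c i] fill an initial segment; its having length [i.+1] makes
    [i] the last position of its color. *)
Definition color_last (n : nat) (c : 'I_n -> nat) (i : 'I_n) : bool :=
  #|[pred j | (c j <= c i)%N]| == i.+1.

Definition color_monotone (n : nat) (c : 'I_n -> nat) : Prop :=
  forall i j : 'I_n, (i <= j)%N -> (c i <= c j)%N.

Section Coloring.

Variables (n : nat) (c : 'I_n -> nat).
Hypothesis c_mono : color_monotone c.

Lemma color_le_card (i : 'I_n) (k : nat) :
  (c i <= k)%N = (i < #|[pred j | (c j <= k)%N]|)%N.
Proof.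
rewrite -downset_ord ?inE // => j l le_jl; rewrite !inE.
exact/leq_trans/c_mono.
Qed.

Lemma color_lt_card (i : 'I_n) (k : nat) :
  (c i < k)%N = (i < #|[pred j | (c j < k)%N]|)%N.
Proof.
rewrite -downset_ord ?inE // => j l le_jl; rewrite !inE.
exact/leq_ltn_trans/c_mono.
Qed.

Lemma color_le_split (k : nat) :
  #|[pred j | (c j <= k)%N]| =
    (#|[pred j | (c j < k)%N]| + #|[pred j | c j == k]|)%N.
Proof.
rewrite -[LHS](cardID [pred j | c j == k]) addnC; congr (_ + _)%N.
  by apply: eq_card => j; rewrite !inE [RHS]ltn_neqAle.
by apply: eq_card => j; rewrite !inE; case: eqP => [->|]; rewrite ?leqnn ?andbF.
Qed.

Lemma color_lastP (i : 'I_n) :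
  reflect (forall j : 'I_n, (i < j)%N -> c j != c i) (color_last c i).
Proof.
have lt_iU : (i < #|[pred j | (c j <= c i)%N]|)%N by rewrite -color_le_card.
have le_Un : (#|[pred j | (c j <= c i)%N]| <= n)%N.
  by rewrite -[leqRHS]card_ord max_card.
apply: (iffP eqP) => [eqU j lt_ij | last_i].
  apply/negP => /eqP eq_c; have := color_le_card j (c i).
  by rewrite eq_c leqnn eqU ltnS leqNgt lt_ij.
apply/eqP; rewrite eqn_leq lt_iU andbT leqNgt; apply/negP => lt_i1U.
have lt_i1n := leq_trans lt_i1U le_Un.
have := color_le_card (Ordinal lt_i1n) (c i); rewrite lt_i1U => le_c.
have /eqP := last_i (Ordinal lt_i1n) (leqnn _); apply.
by apply/eqP; rewrite eqn_leq le_c c_mono //=.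
Qed.

Variables (K : fieldType) (q : K).

(** The class of a last position [i] is an interval ending at [i], so the left side is a shifted
    geometric sum. *)
Lemma color_class_sum (i : 'I_n) : color_last c i ->
  \sum_(j | c j == c i) q ^+ (n - j.+1) =
    q ^+ (n - i.+1) * \sum_(l < #|[pred j | c j == c i]|) q ^+ l.
Proof.
move=> /eqP last_i; have := color_le_split (c i); rewrite last_i.
set L := #|_|; set m := #|_|; rewrite addnC => eq_imL.
have memc (j : 'I_n) : (c j == c i) = (L <= j < i.+1)%N.
  rewrite eqn_leq color_le_card last_i [(c i <= _)%N]leqNgt color_lt_card.
  by rewrite -leqNgt andbC.
under eq_bigl do rewrite memc.
transitivity (\sum_(L <= j < i.+1) q ^+ (n - j.+1)).
  rewrite (big_nat_widen _ _ n) // big_geq_mkord /=.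
  by apply: eq_bigl => j; rewrite andbC.
rewrite big_distrr /= big_nat_rev /= eq_imL -{1}[L]add0n big_addn addnK.
rewrite big_mkord; apply: eq_bigr => l _; rewrite -exprD; congr (_ ^+ _).
by have := ltn_ord l; have := ltn_ord i; lia.
Qed.

Lemma color_last_sum :
  \sum_(i | color_last c i)
     q ^+ (n - i.+1) * (\sum_(l < #|[pred j | c j == c i]|) q ^+ l) =
  \sum_(l < n) q ^+ l.
Proof.
case: n c c_mono color_le_card color_class_sum => [|m] d d_mono leU class_sum.
  by rewrite !big_ord0.
pose U k := #|[pred j | (d j <= k)%N]|.
have U_gt0 (j : 'I_m.+1) : (j < U (d j))%N by rewrite -leU.
have U_le k : (U k <= m.+1)%N by rewrite -[leqRHS]card_ord max_card.
(* [p j] is the last position of the class of [j], so the fibres of [p] are the color classes. *)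
pose p (j : 'I_m.+1) : 'I_m.+1 := inord (U (d j)).-1.
have pE (j : 'I_m.+1) : (p j).+1 = U (d j).
  by rewrite inordK; have := U_gt0 j; have := U_le (d j); lia.
have dp (j : 'I_m.+1) : d (p j) = d j.
  apply/eqP; rewrite eqn_leq leU pE leqnn d_mono //.
  by rewrite -ltnS pE U_gt0.
rewrite [RHS](reindex_inj rev_ord_inj) /=.
rewrite [RHS](partition_big p (color_last d)) /=; last first.
  by move=> j _; rewrite /color_last dp pE.
apply: eq_bigr => i last_i; rewrite -class_sum //; apply: eq_big => [j | j _].
  apply/eqP/eqP => [dji | <-]; last by rewrite dp.
  by apply: val_inj; apply: succn_inj; rewrite pE dji; apply/eqP.
by [].
Qed.

End Coloring.

Lemma color_increasing_lift (n : nat) (c : 'I_n.+1 -> nat) (i : 'I_n.+1)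
    (s : 'S_n) : color_monotone c ->
  color_increasing c (lift_perm i ord_max s) =
    color_last c i && color_increasing (c \o lift i) s.
Proof.
move=> c_mono; apply/forallP/andP => [inc_s | [/(color_lastP c_mono) last_i inc_s] j].
  split.
    apply/(color_lastP c_mono) => j lt_ij; apply/eqP => eq_c.
    have /forallP/(_ j) := inc_s i.
    by rewrite lt_ij eq_c eqxx lift_perm_id ltnNge -ltnS ltn_ord.
  apply/forallP => j; apply/forallP => k.
  have /forallP/(_ (lift i k)) := inc_s (lift i j).
  by rewrite !lift_perm_lift !ltn_lift.
apply/forallP => k; apply/implyP.
(* Lastness of [i] matters only when the earlier position is [i] itself, where the maximum would
   exceed a later value of the same color. *)
have [j' -> | ->] := unliftP i j; have [k' -> | ->] := unliftP i k;
  rewrite ?lift_perm_id ?lift_perm_lift.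
- by rewrite !ltn_lift; have /forallP/(_ k')/implyP := forallP inc_s j'.
- by move=> _; have := ltn_ord (s j'); rewrite /= /bump; lia.
- by case/andP => /last_i; rewrite eq_sym => /negPf->.
- by rewrite ltnn.
Qed.

Lemma qfactS (K : fieldType) (q : K) (n : nat) :
  qfact q n.+1 = (\sum_(j < n.+1) q ^+ j) * qfact q n.
Proof. by rewrite /qfact big_ord_recr mulrC. Qed.

Lemma color_increasing_inv_sum (K : fieldType) (q : K) (a n : nat)
    (c : 'I_n -> nat) : color_monotone c -> (forall i, (c i < a)%N) ->
  (\sum_(s | color_increasing c s) q ^+ inv_nb s) *
    (\prod_(k < a) qfact q #|[pred i | c i == k]|) = qfact q n.
Proof.
elim: n c => [|n IHn] c c_mono c_lt.
  rewrite (big_pred1 1%g) => [|s]; last first.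
    have -> : s = 1%g by apply/permP; case.
    by rewrite [RHS]eqxx; apply/forallP; case.
  rewrite inv_nb_sum big_ord0 expr0 mul1r [RHS]big_ord0 big1 // => k _.
  by rewrite (_ : #|_| = 0%N) /qfact ?big_ord0 //; apply: eq_card0; case.
rewrite (reindex _ (onW_bij _ (lift_perm_max_bij n))) /=.
under eq_bigl do rewrite color_increasing_lift //.
rewrite -(pair_big_dep (color_last c)
  (fun i s => color_increasing (c \o lift i) s)
  (fun i s => q ^+ inv_nb (lift_perm i ord_max s))) /=.
(* Both sides become sums over the position [i] of the maximum, which are compared term by term. *)
rewrite qfactS -(color_last_sum c_mono) !mulr_suml; apply: eq_bigr => i last_i.
rewrite -(IHn (c \o lift i)); last 2 first.
- by move=> j k le_jk; apply: c_mono; rewrite /= leq_bump2.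
- by move=> j; apply: c_lt.
under eq_bigr do rewrite inv_nb_lift_perm_max exprD.
rewrite -mulr_suml -!mulrA mulrCA; congr (_ * _).
rewrite [RHS]mulrCA; congr (_ * _).
have card_lift k : #|[pred j | c j == k]| =
    ((c i == k) + #|[pred j | (c \o lift i) j == k]|)%N.
  rewrite -!sum1_card [LHS]big_mkcond (bigD1_ord i) //= !inE.
  by congr (_ + _)%N; rewrite -big_mkcond.
rewrite (bigD1 (Ordinal (c_lt i))) //= [in RHS](bigD1 (Ordinal (c_lt i))) //=.
rewrite mulrA card_lift eqxx add1n qfactS; congr (_ * _).
apply: eq_bigr => k neq_ki; rewrite card_lift (_ : c i == k = false) //.
by apply: contraNF neq_ki => /eqP eq_ik; apply/eqP/val_inj.
Qed.

(** * Pile sizes as a monotone coloring *)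

Section Piles.

Variables (a n : nat) (b : {ffun 'I_a -> 'I_n.+1}).
Hypothesis a_gt0 : (0 < a)%N.
Hypothesis sum_b : (\sum_i b i)%N = n.

Definition pile_start (k : nat) : nat := (\sum_(j < a | j < k) b j)%N.

(* The pile, numbered from 0, to which a position belongs when the piles are  *)
(* laid out from left to right.                                               *)
Definition pile (i : 'I_n) : nat := #|[pred k : 'I_a | (pile_start k.+1 <= i)%N]|.

Lemma pile_startS (k : 'I_a) : pile_start k.+1 = (pile_start k + b k)%N.
Proof.
rewrite /pile_start (bigD1 k) //= addnC; congr (_ + _)%N.
by apply: eq_bigl => j; rewrite ltnS [RHS]ltn_neqAle andbC.
Qed.

Lemma leq_pile_start (k l : nat) : (k <= l)%N -> (pile_start k <= pile_start l)%N.
Proof.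
move=> le_kl; rewrite /pile_start !(big_mkcond (fun j : 'I_a => (j < _)%N)) /=.
apply: leq_sum => j _; case: ifP => // lt_jk.
by rewrite (leq_trans lt_jk).
Qed.

Lemma pile_start_size : pile_start a = n.
Proof. by rewrite -[RHS]sum_b; apply: eq_bigl => j; rewrite ltn_ord. Qed.

Lemma pile_gtE (i : 'I_n) (k : 'I_a) : (k < pile i)%N = (pile_start k.+1 <= i)%N.
Proof.
rewrite -downset_ord ?inE // => j l le_jl; rewrite !inE; apply: leq_trans.
exact: leq_pile_start.
Qed.

Lemma pile_lt_size (i : 'I_n) : (pile i < a)%N.
Proof.
rewrite ltnNge; apply/negP => le_a.
have lt_a : (a.-1 < a)%N by rewrite prednK.
have := pile_gtE i (Ordinal lt_a); rewrite /= prednK // le_a pile_start_size.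
by rewrite leqNgt ltn_ord.
Qed.

Lemma pile_ltE (i : 'I_n) (k : nat) : (k <= a)%N ->
  (pile i < k)%N = (i < pile_start k)%N.
Proof.
case: k => [|k] le_ka; first by rewrite /pile_start big_pred0.
by rewrite ltnNge (pile_gtE i (Ordinal le_ka)) -ltnNge.
Qed.

Lemma pile_mono : color_monotone pile.
Proof.
move=> i j le_ij; apply/subset_leq_card/subsetP => k; rewrite !inE => le_ki.
exact: leq_trans le_ij.
Qed.

Lemma card_pile (k : 'I_a) : #|[pred i | pile i == k]| = b k.
Proof.
have card_lt l : (l <= a)%N -> #|[pred i | (pile i < l)%N]| = pile_start l.
  move=> le_la; rewrite -[RHS](@card_ord_lt n); last first.
    by rewrite -[leqRHS]pile_start_size leq_pile_start.
  by apply: eq_card => i; rewrite !inE pile_ltE.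
apply: (@addnI (pile_start k)); rewrite -pile_startS -(card_lt k) 1?ltnW //.
by rewrite -color_le_split -card_lt.
Qed.

Lemma mem_cuts (x : 'I_n.+1) :
  reflect (exists k : 'I_a, x = pile_start k.+1 :> nat) (x \in cuts b).
Proof.
rewrite inE; apply: (iffP existsP) => -[k xk]; exists k; exact/eqP.
Qed.

Lemma descents_sub_cuts (s : 'S_n) :
  (descents s \subset cuts b) = color_increasing pile s.
Proof.
apply/subsetP/forallP => [des_s i | inc_s x].
  have adj (j k : 'I_n) : k = j.+1 :> nat -> pile j = pile k -> (s j < s k)%N.
    move=> kE eq_jk; rewrite ltnNge leq_eqVlt negb_or; apply/andP; split.
      by apply/eqP => /val_inj/perm_inj eq_kj; move: kE; rewrite eq_kj; lia.
    apply/negP => lt_kj.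
    have lt_j1n : (j.+1 < n.+1)%N by rewrite ltnS ltn_ord.
    have /des_s/mem_cuts[l /= eq_j1] : Ordinal lt_j1n \in descents s.
      rewrite inE; apply/orP; right; apply/existsP; exists j; apply/existsP.
      by exists k; rewrite /= kE !eqxx.
    have := pile_gtE j l; have := pile_gtE k l.
    by rewrite -eq_j1 kE leqnn ltnn eq_jk => ->.
  (* By monotonicity every position between two positions of a pile lies in that pile, so adjacent
     comparisons chain. *)
  have chain d (j k : 'I_n) : k = (j + d).+1 :> nat -> pile j = pile k ->
      (s j < s k)%N.
    elim: d k => [|d IHd] k kE eq_jk; first by apply: adj => //; rewrite kE addn0.
    have lt_mn : ((j + d).+1 < n)%N by have := ltn_ord k; lia.
    have eq_jm : pile j = pile (Ordinal lt_mn).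
      apply/eqP; rewrite eqn_leq {2}eq_jk !pile_mono //=; lia.
    apply: ltn_trans (IHd (Ordinal lt_mn) erefl eq_jm) _.
    by apply: adj; rewrite -?eq_jm //= kE addnS.
  apply/forallP => j; apply/implyP => /andP[lt_ij /eqP eq_ij].
  by apply: (chain (j - i.+1)%N) eq_ij; lia.
(* The conventional descent at n is the end of the last pile; any other descent must occur at the
   end of the pile of its left position. *)
rewrite inE => /predU1P[xn | ].
  apply/mem_cuts; have lt_a : (a.-1 < a)%N by rewrite prednK.
  by exists (Ordinal lt_a); rewrite /= prednK // pile_start_size.
case/existsP => i /existsP[j /and3P[/eqP ix /eqP jx lt_ji]].
apply/mem_cuts; exists (Ordinal (pile_lt_size i)) => /=.
apply/eqP; rewrite eqn_leq -{1}ix -pile_ltE ?pile_lt_size // leqnn /=.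
rewrite -jx -(pile_gtE j (Ordinal (pile_lt_size i))) /=.
rewrite ltn_neqAle pile_mono ?andbT; last by lia.
apply/eqP => eq_ij; have /forallP/(_ j) := inc_s i.
by rewrite eq_ij eqxx jx -ix leqnn ltnNge ltnW.
Qed.

End Piles.

(** The product form avoids division by q-factorials, so the identity also specializes to q = 1. *)
Lemma shuffles_inv_sum (K : fieldType) (q : K) (a n : nat)
    (b : {ffun 'I_a -> 'I_n.+1}) : (0 < a)%N -> (\sum_i b i)%N = n ->
  (\sum_(s in shuffles b) q ^+ inv_nb s) * \prod_i qfact q (b i) = qfact q n.
Proof.
move=> a_gt0 sum_b.
rewrite -(color_increasing_inv_sum q (pile_mono b) (pile_lt_size a_gt0 sum_b)).
congr (_ * _); last by apply: eq_bigr => k _; rewrite card_pile.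
rewrite (reindex_inj (@invg_inj _)) /=; apply: eq_big => [s | s _].
  by rewrite inE invgK descents_sub_cuts.
by rewrite inv_nbV.
Qed.

(** * The shuffle measure and the first equality *)

Lemma qfact1 (K : fieldType) (n : nat) : qfact (1 : K) n = n`!%:R.
Proof.
elim: n => [|n IHn]; first by rewrite /qfact big_ord0.
rewrite qfactS IHn factS natrM; congr (_ * _).
under eq_bigr do rewrite expr1n.
by rewrite sumr_const card_ord.
Qed.

Lemma qfact_neq0 (K : fieldType) (q : K) (n : nat) :
  (forall m, q ^+ m.+1 != 1) -> qfact q n != 0.
Proof.
move=> q_n1; rewrite prodf_seq_neq0; apply/allP => i _ /=.
by apply: contraNneq (q_n1 i) => sum0; rewrite -subr_eq0 subrX1 sum0 mulr0.
Qed.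

Lemma pile_prob_shuffles (R : realFieldType) (a n : nat) (p : 'I_a -> R)
    (b : {ffun 'I_a -> 'I_n.+1}) : (0 < a)%N -> (\sum_i b i)%N = n ->
  pile_prob p b / #|shuffles b|%:R = \prod_i p i ^+ b i.
Proof.
move=> a_gt0 sum_b.
have eq_n : #|shuffles b|%:R * \prod_i (b i)`!%:R = n`!%:R :> R.
  rewrite -[RHS]qfact1 -(shuffles_inv_sum 1 a_gt0 sum_b); congr (_ * _).
    by rewrite -sum1_card natr_sum; apply: eq_bigr => s _; rewrite expr1n.
  by apply: eq_bigr => i _; rewrite qfact1.
rewrite /pile_prob -eq_n.
have : n`!%:R != 0 :> R by rewrite pnatr_eq0 -lt0n fact_gt0.
rewrite -eq_n mulf_eq0 negb_or => /andP[sh_neq0 fact_neq0].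
by rewrite mulfK // mulrC mulrA mulVf // mul1r.
Qed.

(** Coefficients up to n depend only on the truncations, which reduces products of series to
    products of polynomials. *)
Lemma coef_fps_prod (K : fieldType) (I : Type) (r : seq I) (F : I -> fps K)
    (n m : nat) : (m <= n)%N ->
  coefs (\prod_(i <- r) F i) m = (\prod_(i <- r) fps_trunc n (F i))`_m.
Proof.
elim: r m => [|i r IHr] m le_mn; first by rewrite !big_nil coef1 /=; case: m le_mn.
rewrite !big_cons coefM [LHS]/=; apply: eq_bigr => j _.
have le_jn : (j <= n)%N by rewrite (leq_trans _ le_mn) // -ltnS.
by rewrite IHr ?(leq_trans (leq_subr _ _)) // coef_poly ltnS le_jn.
Qed.

Lemma coef_fps_prod_piles (K : fieldType) (a n : nat) (F : 'I_a -> fps K) :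
  coefs (\prod_i F i) n = \sum_(b in pile_sizes a n) \prod_i coefs (F i) (b i).
Proof.
rewrite (coef_fps_prod _ _ (leqnn n)) /fps_trunc.
under eq_bigr do rewrite poly_def.
rewrite bigA_distr_bigA coef_sum [RHS]big_mkcond /=; apply: eq_bigr => b _.
rewrite scaler_prod -expr_sum coefZ coefXn inE eq_sym.
by case: eqP => _; rewrite ?mulr1 ?mulr0.
Qed.

Lemma inv_gf_prod (R : realFieldType) (a : nat) (p : 'I_a -> R) (K : fieldType)
    (iota : {rmorphism R -> K}) (q : K) :
    (0 < a)%N -> (forall m, q ^+ m.+1 != 1) ->
  inv_gf p iota q = \prod_i qexp q (iota (p i)).
Proof.
move=> a_gt0 q_n1; apply: fpsP => n; rewrite coef_fps_prod_piles /=.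
rewrite /shuffle_expect [X in X / _](_ : _ = \sum_(b in pile_sizes a n)
    iota (\prod_i p i ^+ b i) * \sum_(s in shuffles b) q ^+ inv_nb s).
  rewrite mulr_suml; apply: eq_bigr => b; rewrite inE => /eqP sum_b.
  rewrite big_split /= prodfV -(shuffles_inv_sum q a_gt0 sum_b) rmorph_prod.
  have : qfact q n != 0 by apply: qfact_neq0.
  rewrite -{1}(shuffles_inv_sum q a_gt0 sum_b) mulf_eq0 negb_or => /andP[? ?].
  rewrite -mulrA invfM mulVKf //; congr (_ / _).
  by apply: eq_bigr => i _; rewrite rmorphXn.
(* Exchanging the sums over permutations and pile sizes isolates the q-multinomial sum for each
   [b]. *)
transitivity (\sum_s \sum_(b in pile_sizes a n) iota (pile_prob p b *
    (if s \in shuffles b then #|shuffles b|%:R^-1 else 0)) * q ^+ inv_nb s).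
  by apply: eq_bigr => s _; rewrite rmorph_sum mulr_suml.
rewrite exchange_big; apply: eq_bigr => b; rewrite inE => /eqP sum_b.
rewrite -(pile_prob_shuffles p a_gt0 sum_b) big_distrr [RHS]big_mkcond /=.
by apply: eq_bigr => s _; case: ifP => _; rewrite ?mulr0 ?rmorph0 ?mul0r.
Qed.

Lemma ratfunX_exp_neq1 (R : realFieldType) (m : nat) : ratfunX R ^+ m.+1 != 1.
Proof.
rewrite /ratfunX -tofracXn -tofrac1 tofrac_eq.
by rewrite -subr_eq0 monic_neq0 // monicXnsubC.
Qed.

(** * The Euler product as a limit of finite products *)

Section EulerProduct.

Local Open Scope classical_set_scope.

Lemma coef_linear_mul (K : fieldType) (y : K) (f : fps K) (n : nat) :
  coefs ((1 - fpsX K * fpsC y) * f) n =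
    coefs f n - (if n is m.+1 then y * coefs f m else 0).
Proof.
have coefXC m : coefs (fpsX K * fpsC y) m = if m == 1%N then y else 0.
  case: m => [|m]; first by rewrite /= big_ord1 mul0r.
  rewrite /= !big_ord_recl big1 => [|i _]; last by rewrite mul0r.
  by rewrite mul0r add0r addr0 mul1r subSS subn0 eqSS.
rewrite mulrBl mul1r /=; congr (_ - _).
under eq_bigr do rewrite [X in X * _]coefXC.
case: n => [|n]; first by rewrite big_ord1 mul0r.
rewrite !big_ord_recl big1 => [|i _]; last by rewrite mul0r.
by rewrite /= mul0r add0r addr0 subSS subn0.
Qed.

Lemma qexp_coef (K : fieldType) (q c : K) (n : nat) : q != 1 ->
  c ^+ n / qfact q n = (c * (1 - q)) ^+ n * \prod_(i < n) (1 - q ^+ i.+1)^-1.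
Proof.
move=> q_n1; have q1_neq0 : 1 - q != 0 by rewrite subr_eq0 eq_sym.
have -> : \prod_(i < n) (1 - q ^+ i.+1)^-1 = (1 - q) ^- n * (qfact q n)^-1.
  have -> : (1 - q) ^- n = \prod_(i < n) (1 - q)^-1.
    by rewrite prodr_const card_ord exprVn.
  rewrite -prodfV -big_split /=; apply: eq_bigr => i _; rewrite -invfM.
  by rewrite -[1 - q ^+ _]opprB subrX1 -mulNr opprB.
by rewrite exprMn -mulrA mulVKf // expf_neq0.
Qed.

(* The q-binomial theorem for negative exponents. *)
Lemma coef_euler_partprod (C : numFieldType) (q c : C) (N n : nat) :
    (forall m, q ^+ m.+1 != 1) ->
  coefs (fps_partprod (euler_factor q c) N) n =
    (c * (1 - q)) ^+ n *
      \prod_(i < n) ((1 - q ^+ (N + i)) / (1 - q ^+ i.+1)).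
Proof.
move=> q_n1; set x := c * (1 - q).
pose G M := FPS (fun n => x ^+ n *
  \prod_(i < n) ((1 - q ^+ (M + i)) / (1 - q ^+ i.+1))).
suff -> : fps_partprod (euler_factor q c) N = G N by [].
have unit_lin M : (1 - fpsX C * fpsC (x * q ^+ M)) \is a GRing.unit.
  by rewrite unfold_in /= /fps_unit /= big_ord1 mul0r subr0 oner_neq0.
elim: N => [|N IHN].
  rewrite /fps_partprod big_ord0; apply: fpsP => -[|m] /=.
    by rewrite big_ord0 expr0 mul1r.
  (* For N = 0 the factor at i = 0 is 1 - q^0 = 0, so the positive coefficients vanish. *)
  by rewrite big_ord_recl addn0 expr0 subrr !(mul0r, mulr0).
rewrite /fps_partprod big_ord_recr -/(fps_partprod _ N) IHN /euler_factor -/x /=.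
apply: (canLR (mulrK (unit_lin N))); rewrite mulrC.
apply: fpsP => m; rewrite coef_linear_mul.
case: m => [|m] /=; first by rewrite !big_ord0 subr0.
have q_neq1 i : 1 - q ^+ i.+1 != 0 by rewrite subr_eq0 eq_sym.
rewrite !prodf_div big_ord_recl /=.
rewrite [\prod_(i < m.+1) (1 - q ^+ (N.+1 + i))]big_ord_recr /=.
rewrite [\prod_(i < m.+1) (1 - q ^+ i.+1)]big_ord_recr /=.
rewrite (eq_bigr (fun i : 'I_m => 1 - q ^+ (N.+1 + i))) => [|i _]; last first.
  by rewrite addSnnS.
set A := \prod_(i < m) (1 - q ^+ (N.+1 + i)).
set B := \prod_(i < m) (1 - q ^+ i.+1).
have B_neq0 : B != 0 by apply/prodf_neq0 => i _.
have := q_neq1 m; rewrite addn0 addSn !exprS exprD => qm_neq0.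
(* After removing common factors this is 1 - q^N = (1 - q^(N+m+1)) - q^N (1 - q^(m+1)). *)
by field; apply/andP.
Qed.

Lemma cvg_geometric_complex (R : realType) (q : R[i]) : `|q| < 1 ->
  (fun N : nat => q ^+ N : R[i]^o) @ \oo --> (0 : R[i]^o).
Proof.
move=> q_lt1; have [r rE] : exists r : R, `|q| = r%:C%C by eexists; apply: normc_def.
have r_ge0 : 0 <= r by rewrite -lecR -rE normr_ge0.
have r_lt1 : `|r| < 1 by rewrite ger0_norm // -ltcR -rE.
apply/cvgr0Pnorm_lt => e e_gt0.
have eE : e = (complex.Re e)%:C%C by rewrite RRe_real // gtr0_real.
have : \forall N \near \oo, `|r ^+ N| < complex.Re e.
  have /cvgr0Pnorm_lt := cvg_expr r_lt1.
  by apply; rewrite -ltcR -eE.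
apply: filterS => N lt_rN; rewrite normrX rE -rmorphXn eE ltcR; apply: le_lt_trans lt_rN.
exact: ler_norm.
Qed.

Lemma euler_partprod_cvg (R : realType) (q c : R[i]) (n : nat) : `|q| < 1 ->
  (fun N : nat => coefs (fps_partprod (euler_factor q c) N) n : R[i]^o) @ \oo
    --> (coefs (qexp q c) n : R[i]^o).
Proof.
move=> q_lt1.
have q_n1 m : q ^+ m.+1 != 1.
  by apply: contraTneq (exprn_ilt1 m.+1 (normr_ge0 q) q_lt1) => eq1;
    rewrite -normrX eq1 normr1 ltxx.
rewrite /= (qexp_coef _ _ (q_n1 0)).
under eq_fun do rewrite coef_euler_partprod //.
apply: cvgM; first exact: cvg_cst.
elim: n => [|n IHn].
  by rewrite big_ord0; under eq_fun do rewrite big_ord0; apply: cvg_cst.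
rewrite big_ord_recr; under eq_fun do rewrite big_ord_recr.
apply: cvgM IHn _; rewrite -[X in _ --> X]mul1r; apply: cvgM (cvg_cst _).
rewrite -[X in _ --> X]subr0 -(mul0r (q ^+ n)).
under eq_fun do rewrite exprD.
apply: cvgB; first exact: cvg_cst.
by apply: cvgM (cvg_cst _); apply: cvg_geometric_complex.
Qed.

Lemma euler_product (R : realType) (q c : R[i]) : `|q| < 1 ->
  fps_cvgn (fps_partprod (euler_factor q c)) /\
  fps_infprod (euler_factor q c) = qexp q c.
Proof.
move=> q_lt1; split=> [n|].
  by apply/cvg_ex; exists (coefs (qexp q c) n); apply: euler_partprod_cvg.
apply: fpsP => n; apply: cvg_lim; first exact: norm_hausdorff.
exact: euler_partprod_cvg.
Qed.

End EulerProduct.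

Theorem theorem5 (R : realType) (a : nat) (p : 'I_a -> R)
    (ha : (1 <= a)%N) (hp0 : forall i, 0 <= p i) (hp1 : \sum_i p i = 1) :
  inv_gf p (ratfunC R) (ratfunX R) =
    \prod_(i < a) qexp (ratfunX R) (ratfunC R (p i))
  /\
  forall q : R[i], `|q| < 1 ->
    (forall i : 'I_a,
       fps_cvgn (fps_partprod (euler_factor q (RtoC R (p i))))) /\
    \prod_(i < a) qexp q (RtoC R (p i)) =
      \prod_(i < a) fps_infprod (euler_factor q (RtoC R (p i))).
Proof.
split; first exact: inv_gf_prod ha (@ratfunX_exp_neq1 R).
move=> q q_lt1; split=> [i|]; first by case: (euler_product (RtoC R (p i)) q_lt1).
by apply: eq_bigr => i _; case: (euler_product (RtoC R (p i)) q_lt1).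
Qed.
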